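(* Let $K$ be a field and $R=K[x_{12},x_{13},x_{23},y_1,y_2,y_3]$ a polynomial ring. Put $g_{13}=x_{12}y_2+x_{13}y_3$, $g_{23}=-x_{12}y_1+x_{23}y_3$, $g_{33}=-x_{13}y_1-x_{23}y_2$, and let $L_3=\langle g_{13},g_{23},g_{33}\rangle$. Then a minimal free resolution of $R/L_3$ is $$0\longrightarrow R^{2}\stackrel{d_{23}}{\longrightarrow}R^{3}\stackrel{d_{13}}{\longrightarrow}R\stackrel{d_{03}}{\longrightarrow}R/L_3\longrightarrow 0,$$ where $d_{03}$ is the projection map, $$d_{13}=\begin{pmatrix}g_{13}&g_{23}&g_{33}\end{pmatrix},\qquad d_{23}=\begin{pmatrix}x_{23}&y_1\\ -x_{13}&y_2\\ x_{12}&y_3\end{pmatrix}.$$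
   Context: The polynomials $g_{13},g_{23},g_{33}$ are the entries of $X_3Y_3$, where $X_3=\begin{pmatrix}0&x_{12}&x_{13}\\ -x_{12}&0&x_{23}\\ -x_{13}&-x_{23}&0\end{pmatrix}$ and $Y_3=(y_1,y_2,y_3)^T$, so $L_3=I_1(X_3Y_3)$ is the ideal generated by the entries of $X_3Y_3$. Matrices act on column vectors. Minimality is in the sense of graded free resolutions over the standard graded ring $R$ (a resolution whose differentials have all matrix entries in the homogeneous maximal ideal generated by the variables). *)

(* Defs.v *)
From HB Require Import structures.
From mathcomp Require Import all_boot all_order all_algebra.
From mathcomp Require Import generic_quotient ring_quotient boolp mpoly.

Set Implicit Arguments.
Unset Strict Implicit.
Unset Printing Implicit Defensive.

Import GRing.Theory.
Local Open Scope ring_scope.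
Local Open Scope quotient_scope.

Section IdealQuotient.
Variables (R : comNzRingType) (s : seq R).

(* The quotients of ring_quotient are taken by boolean predicates, hence the
   classical truth value of "p is an R-linear combination of s". *)
Definition ideal_gen : {pred R} :=
  fun p => `[< exists c : 'I_(size s) -> R, p = \sum_i c i * s`_i >].

Lemma ideal_genP p :
  reflect (exists c : 'I_(size s) -> R, p = \sum_i c i * s`_i)
          (p \in ideal_gen).
Proof. exact: asboolP. Qed.

Lemma ideal_gen_zmod_closed : zmod_closed ideal_gen.
Proof.
split=> [|_ _ /ideal_genP[c ->] /ideal_genP[d ->]]; apply/ideal_genP.
  by exists (fun=> 0); rewrite big1 // => i _; rewrite mul0r.
exists (fun i => c i - d i); rewrite -sumrB.
by apply: eq_bigr => i _; rewrite mulrBl.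
Qed.

HB.instance Definition _ :=
  GRing.isZmodClosed.Build R ideal_gen ideal_gen_zmod_closed.

Lemma ideal_genMl a p : p \in ideal_gen -> a * p \in ideal_gen.
Proof.
move=> /ideal_genP[c ->]; apply/ideal_genP; exists (fun i => a * c i).
by rewrite mulr_sumr; apply: eq_bigr => i _; rewrite mulrA.
Qed.

(* The R-module R/(s). The ring structure of {ideal_quot _} would require (s)
   to be proper and does not come with a scalar action of R. *)
Definition quot_mod : Type := {ideal_quot ideal_gen}.

HB.instance Definition _ := GRing.Zmodule.on quot_mod.

Definition quot_proj (p : R^o) : quot_mod := \pi_({ideal_quot ideal_gen}) p.

Lemma quot_proj_eq p q : (quot_proj p == quot_proj q) = (p - q \in ideal_gen).
Proof. exact/esym/(Quotient.idealrBE ideal_gen p q). Qed.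

Lemma quot_projK (x : quot_mod) :
  quot_proj (repr (x : {ideal_quot ideal_gen})) = x.
Proof. exact: reprK. Qed.

Lemma quot_projD p q : quot_proj (p + q) = quot_proj p + quot_proj q.
Proof. exact: (raddfD \pi_({ideal_quot ideal_gen}) p q). Qed.

Definition quot_scale (a : R) (x : quot_mod) : quot_mod :=
  quot_proj (a * repr (x : {ideal_quot ideal_gen})).

Lemma quot_scaleE a p : quot_scale a (quot_proj p) = quot_proj (a * p).
Proof.
apply/eqP; rewrite quot_proj_eq -mulrBr ideal_genMl // -quot_proj_eq.
by rewrite quot_projK.
Qed.

Lemma quot_scaleA a b x : quot_scale a (quot_scale b x) = quot_scale (a * b) x.
Proof. by rewrite -[x]quot_projK !quot_scaleE mulrA. Qed.

Lemma quot_scale1 : left_id 1 quot_scale.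
Proof. by move=> x; rewrite -[x]quot_projK quot_scaleE mul1r. Qed.

Lemma quot_scaleDr : right_distributive quot_scale +%R.
Proof.
move=> a x y; rewrite -[x]quot_projK -[y]quot_projK -quot_projD.
by rewrite !quot_scaleE mulrDr quot_projD.
Qed.

Lemma quot_scaleDl x : {morph quot_scale^~ x : a b / a + b}.
Proof.
by move=> a b; rewrite -[x]quot_projK !quot_scaleE mulrDl quot_projD.
Qed.

HB.instance Definition _ := GRing.Zmodule_isLmodule.Build R quot_mod
  quot_scaleA quot_scale1 quot_scaleDr quot_scaleDl.

(* The projection on the rank one free module of columns of height 1, which
   plays the role of R in resolutions whose differentials are matrices. *)
Definition quot_aug (v : 'cV[R]_1) : quot_mod := quot_proj (v 0 0).

Lemma quot_aug_linear : linear quot_aug.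
Proof.
by move=> a u v; rewrite /quot_aug !mxE quot_projD -quot_scaleE.
Qed.

HB.instance Definition _ :=
  GRing.isLinear.Build R 'cV[R]_1 quot_mod *:%R quot_aug quot_aug_linear.

End IdealQuotient.

Definition exact_at (U V W : zmodType) (f : U -> V) (g : V -> W) : Prop :=
  forall v, g v = 0 <-> exists u, f u = v.

Section Resolution.
Variables (K : fieldType) (n : nat).
Local Notation R := {mpoly K[n]}.
Variables (r0 r1 r2 : nat).

(* Exactness of 0 -> R^r2 -> R^r1 -> R^r0 -> M -> 0, where matrices act on
   columns. *)
Definition free_resolution (M : lmodType R) (d0 : {linear 'cV[R]_r0 -> M})
    (d1 : 'M[R]_(r0, r1)) (d2 : 'M[R]_(r1, r2)) : Prop :=
  [/\ forall x : M, exists v, d0 v = x,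
      exact_at (mulmx d1 : 'cV_r1 -> 'cV_r0) d0,
      exact_at (mulmx d2 : 'cV_r2 -> 'cV_r1) (mulmx d1 : 'cV_r1 -> 'cV_r0)
    & injective (mulmx d2 : 'cV_r2 -> 'cV_r1)].

(* A is homogeneous of degree 0 as a map from the sum of the R(- b j) to the
   sum of the R(- a i). *)
Definition graded_mx (p q : nat) (a : 'I_p -> nat) (b : 'I_q -> nat)
    (A : 'M[R]_(p, q)) : Prop :=
  forall i j, A i j != 0 ->
    (a i <= b j)%N /\ A i j \is (b j - a i)%N.-homog.

Definition irrelevant_ideal : {pred R} := ideal_gen [seq 'X_i | i : 'I_n].

(* a gives the degrees of the images in M of the basis elements of R^r0; the
   degrees of the other two bases are existentially quantified. *)
Definition minimal_graded_free_resolution (M : lmodType R)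
    (a : 'I_r0 -> nat) (d0 : {linear 'cV[R]_r0 -> M})
    (d1 : 'M[R]_(r0, r1)) (d2 : 'M[R]_(r1, r2)) : Prop :=
  [/\ free_resolution d0 d1 d2,
      exists b c, graded_mx a b d1 /\ graded_mx b c d2,
      forall i j, d1 i j \in irrelevant_ideal
    & forall i j, d2 i j \in irrelevant_ideal].

End Resolution.

Section GenericAlternating3.
Variable K : fieldType.
Local Notation R := {mpoly K[6]}.

Definition x12 : R := 'X_(@Ordinal 6 0 isT).
Definition x13 : R := 'X_(@Ordinal 6 1 isT).
Definition x23 : R := 'X_(@Ordinal 6 2 isT).
Definition y1 : R := 'X_(@Ordinal 6 3 isT).
Definition y2 : R := 'X_(@Ordinal 6 4 isT).
Definition y3 : R := 'X_(@Ordinal 6 5 isT).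

Definition g13 : R := x12 * y2 + x13 * y3.
Definition g23 : R := - x12 * y1 + x23 * y3.
Definition g33 : R := - x13 * y1 - x23 * y2.

Definition L3_gens : seq R := [:: g13; g23; g33].

Definition d03 : {linear 'cV[R]_1 -> quot_mod L3_gens} :=
  @quot_aug _ L3_gens.

Definition d13 : 'M[R]_(1, 3) := \row_j L3_gens`_j.

Definition d23 : 'M[R]_(3, 2) :=
  \matrix_(i, j) (nth [::] [:: [::   x23; y1];
                               [:: - x13; y2];
                               [::   x12; y3]] i)`_j.

End GenericAlternating3.

(* Main.v *)
(* Up to sign, (g13, g23, g33) is the cross product of the columns
   u = (x23, - x13, x12) and y = (y1, y2, y3) of d23, so a syzygy v satisfies
   det (v, u, y) = 0. Over the fraction field v = s u + t y, and Cramer's rule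
   writes both s and t as fractions with denominator g13 and also with
   denominator g33. In the degree lexicographic order the leading monomials
   x12 y2 of g13 and x13 y1 of g33 are coprime, so g13, g33 is a regular
   sequence and s, t are polynomials. *)
Require Import Defs.
From mathcomp Require Import all_boot all_order all_algebra.
From mathcomp Require Import mpoly.
From mathcomp Require Import ring.

Set Implicit Arguments.
Unset Strict Implicit.
Unset Printing Implicit Defensive.

Import Order.TTheory GRing.Theory.
Local Open Scope ring_scope.

Section CoprimeLeadingMonomials.
Variables (K : fieldType) (n : nat).
Implicit Types p q a b : {mpoly K[n]}.

Definition coprime_mnm (u v : 'X_{1..n}) :=
  [forall i, (u i == 0%N) || (v i == 0%N)].

(** The leading monomial of [a - b] is at most the common one, at which its coefficient cancels. *)
Lemma lt_mlead_cancel a b :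
  mlead b = mlead a -> mleadc b = mleadc a -> a != b ->
  (mlead (a - b)%R < mlead a)%O.
Proof.
move=> eq_m eq_c ne_ab; rewrite lt_neqAle; apply/andP; split; last first.
  by have := mleadB_le a b; rewrite eq_m joinxx.
apply/eqP => eq_lead; move: (ne_ab); rewrite -subr_eq0 -mleadc_eq0 eq_lead.
by rewrite mcoeffB -eq_c eq_m subrr eqxx.
Qed.

(* Division of a by q never gets stuck: the leading monomial of q divides that
   of a * p and is coprime to that of p, so it divides that of a. *)
Lemma coprime_mlead_dvd p q : p != 0 -> q != 0 ->
  coprime_mnm (mlead p) (mlead q) ->
  forall a b, a * p = b * q -> exists c, a = c * q.
Proof.
move=> nz_p nz_q /forallP cop a.
move: {2}(mlead a) (erefl (mlead a)) => m.
elim/(well_founded_ind (@ltom_wf n)): m a => m IH a Em b ab.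
have [->|nz_a] := eqVneq a 0; first by exists 0; rewrite mul0r.
have nz_b : b != 0.
  apply: contra_neq nz_a => b0; move/eqP: ab.
  by rewrite b0 mul0r mulf_eq0 (negbTE nz_p) orbF => /eqP.
have le_qa : (mlead q <= mlead a)%MM.
  apply/mnm_lepP => i; have /(congr1 (fun p => mlead p i)) := ab.
  rewrite !mleadM // !mnmDE; case/orP: (cop i) => /eqP -> //.
  by rewrite addn0 => ->; rewrite leq_addl.
(* Quotient of the leading terms, so that [c * q] and [a] have the same leading term. *)
pose c := (mleadc a / mleadc q) *: 'X_[mlead a - mlead q] : {mpoly K[n]}.
have nz_k : mleadc a / mleadc q != 0 by rewrite mulf_neq0 ?invr_eq0 ?mleadc_eq0.
have nz_c : c != 0
  by rewrite -mleadc_eq0 mleadZ // mcoeffZ mleadXm mcoeffX eqxx mulr1.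
have Ec : mlead c = (mlead a - mlead q)%MM by rewrite mleadZ // mleadXm.
have Ecq : mlead (c * q) = mlead a by rewrite mleadM // Ec submK.
have Ecc : mleadc (c * q) = mleadc a.
  by rewrite mleadM // mleadcM Ec mcoeffZ mcoeffX eqxx mulr1 divfK ?mleadc_eq0.
have [->|ne] := eqVneq a (c * q); first by exists c.
have lt := lt_mlead_cancel Ecq Ecc ne; rewrite Em in lt.
(* Subtracting [c * q * p] from both sides of [ab] keeps its shape, with cofactors [a - c * q] and
   [b - c * p]. *)
have [|d /eqP] := IH _ lt _ (erefl _) (b - c * p).
  by rewrite !mulrBl ab mulrAC.
by rewrite subr_eq -mulrDl => /eqP ->; exists (d + c).
Qed.

End CoprimeLeadingMonomials.

Lemma mlead_binomial (K : fieldType) (n : nat) (m1 m2 : 'X_{1..n}) :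
  (m2 < m1)%O -> mlead ('X_[m1] + 'X_[m2] : {mpoly K[n]}) = m1.
Proof.
move=> lt; rewrite mleadDl mleadXm //.
by rewrite mleadXm.
Qed.

Lemma mpolyX_homog (n : nat) (S : nzRingType) (i : 'I_n) :
  ('X_i : {mpoly S[n]}) \is 1.-homog.
Proof. by rewrite dhomogX /= mdeg1. Qed.

Lemma mem_ideal_gen (S : comNzRingType) (s : seq S) p :
  p \in s -> p \in ideal_gen s.
Proof.
move=> ps; have lt : (index p s < size s)%N by rewrite index_mem.
apply/ideal_genP; exists (fun i => (i == Ordinal lt)%:R).
rewrite (bigD1 (Ordinal lt)) //= eqxx mul1r nth_index // big1 ?addr0 //.
by move=> i /negbTE ->; rewrite mul0r.
Qed.

(** The coefficients witnessing membership in [ideal_gen s] are exactly the coordinates of a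
    preimage under the row of generators. *)
Lemma exact_quot_aug (S : comNzRingType) (s : seq S) :
  exact_at (mulmx (\row_(j < size s) s`_j) : 'cV_(size s) -> 'cV_1)
    (@quot_aug _ s).
Proof.
move=> v; have aug0 : @quot_proj _ s 0 = 0.
  by apply: (addrI (@quot_proj _ s 0)); rewrite -quot_projD !addr0.
split=> [/eqP|[u <-]].
  rewrite /quot_aug -aug0 quot_proj_eq subr0 => /ideal_genP[c vE].
  exists (\col_i c i); apply/matrixP => i j; rewrite !ord1 vE mxE.
  by apply: eq_bigr => k _; rewrite !mxE mulrC.
apply/eqP; rewrite /quot_aug -aug0 quot_proj_eq subr0; apply/ideal_genP.
exists (fun i => u i 0); rewrite mxE.
by apply: eq_bigr => k _; rewrite !mxE mulrC.
Qed.

Lemma mpolyX_irrelevant (n : nat) (F : fieldType) (i : 'I_n) :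
  ('X_i : {mpoly F[n]}) \in @irrelevant_ideal F n.
Proof. by apply: mem_ideal_gen; apply/mapP; exists i; rewrite ?mem_enum. Qed.

Section GenericAlternating3.
Variable K : fieldType.
Local Notation R := {mpoly K[6]}.
Local Notation x12 := (x12 K).
Local Notation x13 := (x13 K).
Local Notation x23 := (x23 K).
Local Notation y1 := (y1 K).
Local Notation y2 := (y2 K).
Local Notation y3 := (y3 K).
Local Notation g13 := (g13 K).
Local Notation g23 := (g23 K).
Local Notation g33 := (g33 K).
Local Notation i12 := (@Ordinal 6 0 isT).
Local Notation i13 := (@Ordinal 6 1 isT).
Local Notation i23 := (@Ordinal 6 2 isT).
Local Notation j1 := (@Ordinal 6 3 isT).
Local Notation j2 := (@Ordinal 6 4 isT).
Local Notation j3 := (@Ordinal 6 5 isT).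

(** Both monomials have degree 2, so the tie is broken by the first variable, [x12]. *)
Lemma mlead_g13 : mlead g13 = (U_(i12) + U_(j2))%MM.
Proof.
rewrite -[RHS](@mlead_binomial K _ _ (U_(i13) + U_(j3))%MM).
  by rewrite !mpolyXD.
apply/ltmcP; first by rewrite !mdegD !mdeg1.
by exists i12 => //; rewrite !mnmDE !mnm1E.
Qed.

Lemma mlead_g33 : mlead g33 = (U_(i13) + U_(j1))%MM.
Proof.
(* Both coefficients of [g33] are -1, so [- g33] is a binomial with coefficients 1. *)
rewrite -mleadN -[RHS](@mlead_binomial K _ _ (U_(i23) + U_(j2))%MM).
  by rewrite !mpolyXD /g33 mulNr opprD !opprK.
apply/ltmcP; first by rewrite !mdegD !mdeg1.
exists i13 => [[[|[|j]] //= lt] lt1|]; rewrite !mnmDE !mnm1E //.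
Qed.

Lemma g13_neq0 : g13 != 0.
Proof.
apply/eqP => /(congr1 (@mlead _ _)); rewrite mlead_g13 mlead0.
by move/mnmP/(_ i12); rewrite mnmDE !mnm1E mnm0E.
Qed.

Lemma g33_neq0 : g33 != 0.
Proof.
apply/eqP => /(congr1 (@mlead _ _)); rewrite mlead_g33 mlead0.
by move/mnmP/(_ i13); rewrite mnmDE !mnm1E mnm0E.
Qed.

(** This is the regularity of the sequence [g33], [g13]: the monomials [x12 * y2] and [x13 * y1]
    share no variable. *)
Lemma g33_dvd a b : a * g13 = b * g33 -> exists c, a = c * g33.
Proof.
apply: coprime_mlead_dvd g13_neq0 g33_neq0 _ _ _.
rewrite mlead_g13 mlead_g33; apply/forallP => i; rewrite !mnmDE !mnm1E.
by case: i => [[|[|[|[|[|[|]]]]]]].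
Qed.

(* Ec and Ed compare two coordinates of the cross products of v with y and
   with u. *)
Lemma syzygy_d23 (v1 v2 v3 : R) : v1 * g13 + v2 * g23 + v3 * g33 = 0 ->
  exists s t, [/\ v1 = x23 * s + y1 * t, v2 = - x13 * s + y2 * t
    & v3 = x12 * s + y3 * t].
Proof.
move=> v0.
have Ec : (v1 * y2 - v2 * y1) * g13 = (v2 * y3 - v3 * y2) * g33.
  (* The difference of the two sides is [y2] times the syzygy, because
     [y1 * g13 + y2 * g23 + y3 * g33 = 0]. *)
  apply/eqP; rewrite -subr_eq0 -(mul0r y2) -v0; apply/eqP.
  by rewrite /g13 /g23 /g33; ring.
have Ed : (x23 * v2 + x13 * v1) * g13 = (- x13 * v3 - x12 * v2) * g33.
  (* Here it is [x13] times the syzygy, because [x23 * g13 - x13 * g23 + x12 * g33 = 0]. *)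
  apply/eqP; rewrite -subr_eq0 -(mulr0 x13) -v0; apply/eqP.
  by rewrite /g13 /g23 /g33; ring.
have [c Hc] := g33_dvd Ec; have [d Hd] := g33_dvd Ed.
have Hc1 : v2 * y3 - v3 * y2 = c * g13.
  by apply: (mulIf g33_neq0); rewrite -Ec Hc; ring.
have Hd1 : - x13 * v3 - x12 * v2 = d * g13.
  by apply: (mulIf g33_neq0); rewrite -Ed Hd; ring.
(* The signs arise because the third coordinate of the cross product of u and y is [- g33]. *)
exists (- c), (- d); split.
- apply: (mulIf g33_neq0).
  transitivity (- x23 * (c * g33) - y1 * (d * g33)); last by ring.
  by rewrite -Hc -Hd /g33; ring.
- apply: (mulIf g33_neq0).
  transitivity (x13 * (c * g33) - y2 * (d * g33)); last by ring.
  by rewrite -Hc -Hd /g33; ring.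
(* With the factor [g13] this is an identity in the [v]'s; with [g33] it would need [v0] again. *)
- apply: (mulIf g13_neq0).
  transitivity (- x12 * (c * g13) - y3 * (d * g13)); last by ring.
  by rewrite -Hc1 -Hd1 /g13; ring.
Qed.

(** Cramer's rule: the minor of the first two rows of [d23] is [- g33], nonzero in a domain. *)
Lemma d23_ker0 (s t : R) : x23 * s + y1 * t = 0 -> - x13 * s + y2 * t = 0 ->
  s = 0 /\ t = 0.
Proof.
move=> e1 e2; split; apply/eqP.
- have : s * g33 == 0.
    suff -> : s * g33 = y1 * (- x13 * s + y2 * t) - y2 * (x23 * s + y1 * t).
      by rewrite e1 e2 !mulr0 subr0.
    by rewrite /g33; ring.
  by rewrite mulf_eq0 (negbTE g33_neq0) orbF.
- have : t * g33 == 0.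
    suff -> : t * g33 = - x23 * (- x13 * s + y2 * t)
        - x13 * (x23 * s + y1 * t).
      by rewrite e1 e2 !mulr0 subr0.
    by rewrite /g33; ring.
  by rewrite mulf_eq0 (negbTE g33_neq0) orbF.
Qed.

Lemma mul_d13E (v : 'cV[R]_3) : d13 K *m v =
  (v 0 0 * g13 + v 1 0 * g23 + v (inord 2) 0 * g33)%:M.
Proof.
apply/matrixP => i j; rewrite !ord1 !mxE !big_ord_recl big_ord0 !mxE /=.
rewrite mulr1n addr0 addrA ![_ * v _ _]mulrC.
by congr (v _ _ * _ + v _ _ * _ + v _ _ * _); apply/val_inj; rewrite /= ?inordK.
Qed.

Lemma mul_d23E (w : 'cV[R]_2) (v : 'cV[R]_3) : d23 K *m w = v <->
  [/\ x23 * w 0 0 + y1 * w 1 0 = v 0 0, - x13 * w 0 0 + y2 * w 1 0 = v 1 0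
    & x12 * w 0 0 + y3 * w 1 0 = v (inord 2) 0].
Proof.
have E : d23 K *m w = \col_(i < 3)
    [:: x23 * w 0 0 + y1 * w 1 0; - x13 * w 0 0 + y2 * w 1 0;
        x12 * w 0 0 + y3 * w 1 0]`_i.
  apply/matrixP => i j; rewrite ord1 !mxE !big_ord_recl big_ord0 !mxE addr0.
  have -> : lift 0 0 = 1 :> 'I_2 by apply/val_inj.
  by case: i => [[|[|[|]]]].
have e2 : inord 2 = 2 :> 'I_3 by apply/val_inj; rewrite /= inordK.
rewrite {}E e2; split=> [<-|[v0 v1 v2]]; first by rewrite !mxE.
apply/matrixP => i j; rewrite ord1 mxE.
case: i => [[|[|[|//]]] lt] /=; rewrite ?v0 ?v1 ?v2.
all: by congr (v _ _); apply/val_inj.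
Qed.

End GenericAlternating3.

Theorem mainTheorem2 (K : fieldType) :
  minimal_graded_free_resolution (fun _ : 'I_1 => 0%N) (d03 K) (d13 K) (d23 K).
Proof.
have irr := @mpolyX_irrelevant 6 K.
have homX i := @mpolyX_homog 6 K i.
have homXX i j : ('X_i * 'X_j : {mpoly K[6]}) \is 2.-homog
  by exact: dhomogM (homX i) (homX j).
split.
- split.
  + move=> x; exists (repr x)%:M.
    by rewrite /d03 /= /quot_aug mxE eqxx mulr1n quot_projK.
  + exact: exact_quot_aug.
  + move=> v; split=> [|[w /mul_d23E[v0 v1 v2]]]; rewrite mul_d13E.
      move/matrixP/(_ 0 0); rewrite !mxE mulr1n.
      move=> /syzygy_d23[s [t [v0 v1 v2]]].
      exists (\col_i [:: s; t]`_i); apply/mul_d23E.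
      by rewrite !mxE /=.
    rewrite -v0 -v1 -v2 [X in X%:M](_ : _ = 0) ?raddf0 //.
    (* Both columns of [d23] are orthogonal to [(g13, g23, g33)]. *)
    by rewrite /g13 /g23 /g33; ring.
  + move=> w w' e.
    have /mul_d23E[] : d23 K *m (w - w') = 0 by rewrite mulmxBr e subrr.
    rewrite ![(0 : 'M_(_, _)) _ _]mxE => e1 e2 _.
    have [w0 w1] := d23_ker0 e1 e2.
    apply/eqP; rewrite -subr_eq0; apply/eqP/matrixP => i j.
    rewrite ord1 [RHS]mxE.
    case: i => [[|[|//]]] lt; [rewrite -[RHS]w0 | rewrite -[RHS]w1];
    by congr (fun_of_matrix (w - w') _ _); apply/val_inj.
(* The generators are quadrics and the entries of [d23] are linear, whence the shifts 2 and 2 +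
   1. *)
- exists (fun=> 2%N), (fun=> 3%N); split=> i j _; split=> //; rewrite mxE.
  + by case: j => [[|[|[|//]]]] lt;
      [apply: rpredD | apply: rpredD | apply: rpredB];
      rewrite ?mulNr ?rpredN; apply: homXX.
  + case: i j => [[|[|[|//]]]] lt [[|[|//]]] lt' /=; rewrite ?rpredN //;
      exact: homX.
- move=> i j; rewrite mxE.
  by case: j => [[|[|[|//]]]] lt;
    [apply: rpredD | apply: rpredD | apply: rpredB];
    rewrite ?mulNr ?rpredN; apply: ideal_genMl; apply: irr.
- move=> i j; rewrite mxE.
  case: i j => [[|[|[|//]]]] lt [[|[|//]]] lt' /=; rewrite ?rpredN; exact: irr.
Qed.
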